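(* Let $\Bbbk$ be a field, let $G$ be a nontrivial finite group with $\operatorname{char}\Bbbk\nmid|G|$, and let $R$ be a noetherian left $G$-module algebra over $\Bbbk$ with finite Gelfand–Kirillov dimension. Let $B=R*G$ be the skew group algebra and $e=\frac1{|G|}\sum_{g\in G}g\in\Bbbk G\subseteq B$. Then the two definitions of the pertinency of the $G$-action on $R$ agree: $$\operatorname{GKdim}(R)-\operatorname{GKdim}(R/\mathfrak r(R,G))=\operatorname{GKdim}(R)-\operatorname{GKdim}(B/BeB),$$ where $\mathfrak r(R,G)$ is the $G$-radical of $R$.
   Context: Noetherian means left and right noetherian. A left $G$-module algebra $R$ is a $\Bbbk$-algebra on which $G$ acts by $\Bbbk$-algebra automorphisms. The skew group algebra $R*G$ is $R\otimes\Bbbk G$ with $(r\otimes g)(s\otimes h)=r(g\cdot s)\otimes gh$. Two sequences $(a_1,\dots,a_n)$, $(b_1,\dots,b_n)$ of elements of $R$ are pertinent under the $G$-action if $\sum_{i=1}^n a_i(g\cdot b_i)=0$ for all $1\ne g\in G$. The $G$-radical of $R$ is the two-sided ideal $\mathfrak r(R,G)=\{\sum_{i=1}^n a_ib_i: n\ge1,\ (a_1,\dots,a_n),(b_1,\dots,b_n)\text{ pertinent under the }G\text{-action}\}$. *)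

(* Defs.v *)
From HB Require Import structures.
From mathcomp Require Import all_boot all_order all_algebra all_fingroup.
From mathcomp Require Import generic_quotient ring_quotient.
From mathcomp Require Import all_classical all_reals all_analysis.

Set Implicit Arguments.
Unset Strict Implicit.
Unset Printing Implicit Defensive.

Import Order.TTheory GRing.Theory Num.Theory.
Local Open Scope classical_set_scope.
Local Open Scope ring_scope.

(* Unital associative algebras over k. The library's algType excludes the     *)
(* zero algebra, which does occur below as a quotient, and its hierarchy has   *)
(* no place for a structure joining pzRingType and lmodType below lalgType.    *)
Record pzAlgType (k : pzRingType) := PzAlgType {
  pzalg_ring : pzRingType;
  pzalg_scale : k -> pzalg_ring -> pzalg_ring;
  pzalg_scalerA : forall c d x,
    pzalg_scale c (pzalg_scale d x) = pzalg_scale (c * d) x;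
  pzalg_scale1r : left_id 1 pzalg_scale;
  pzalg_scalerDr : right_distributive pzalg_scale +%R;
  pzalg_scalerDl : forall x, {morph pzalg_scale^~ x : c d / c + d};
  pzalg_scalerAl : forall c x y,
    pzalg_scale c (x * y) = pzalg_scale c x * y;
  pzalg_scalerAr : forall c x y,
    pzalg_scale c (x * y) = x * pzalg_scale c y
}.

Definition pzalg_sort (k : pzRingType) (A : pzAlgType k) : Type := pzalg_ring A.
Coercion pzalg_sort : pzAlgType >-> Sortclass.

HB.instance Definition _ (k : pzRingType) (A : pzAlgType k) :=
  GRing.PzRing.on (pzalg_sort A).
HB.instance Definition _ (k : pzRingType) (A : pzAlgType k) :=
  GRing.Zmodule_isLmodule.Build k (pzalg_sort A) (@pzalg_scalerA k A)
    (@pzalg_scale1r k A) (@pzalg_scalerDr k A) (@pzalg_scalerDl k A).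

Lemma pzscalerAl (k : pzRingType) (A : pzAlgType k) (c : k) (x y : A) :
  c *: (x * y) = (c *: x) * y.
Proof. exact: pzalg_scalerAl. Qed.

Lemma pzscalerAr (k : pzRingType) (A : pzAlgType k) (c : k) (x y : A) :
  c *: (x * y) = x * (c *: y).
Proof. exact: pzalg_scalerAr. Qed.

Definition left_ideal (A : pzRingType) (I : set A) : Prop :=
  [/\ I 0, forall x y, I x -> I y -> I (x + y) &
      forall a x, I x -> I (a * x)].

Definition right_ideal (A : pzRingType) (I : set A) : Prop :=
  [/\ I 0, forall x y, I x -> I y -> I (x + y) &
      forall a x, I x -> I (x * a)].

Definition acc (A : Type) (P : set A -> Prop) : Prop :=
  forall I : nat -> set A, (forall n, P (I n)) ->
    (forall n, I n `<=` I n.+1) ->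
    exists N, forall n, (N <= n)%N -> I n = I N.

Definition noetherian (A : pzRingType) : Prop :=
  acc (@left_ideal A) /\ acc (@right_ideal A).

HB.mixin Record isIdeal2 (A : pzRingType) (I : pred A) := {
  ideal2Ml : forall a x, x \in I -> a * x \in I;
  ideal2Mr : forall a x, x \in I -> x * a \in I
}.
(* Two-sided ideals, not necessarily proper.                                   *)
#[short(type="ideal2")]
HB.structure Definition Ideal2 (A : pzRingType) :=
  {I of GRing.ZmodClosed A I & isIdeal2 A I}.

(* The library only puts a ring structure on quotients of nonzero commutative  *)
(* rings by proper ideals; the alias keeps its quotient group and equips it    *)
(* with the algebra structure of A/I for an arbitrary two-sided ideal I.       *)
Definition quot_alg_type (A : pzRingType) (I : ideal2 A) : Type := {ideal_quot I}.

Section QuotientAlgebra.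
Local Open Scope quotient_scope.
Variables (k : pzRingType) (A : pzAlgType k) (I : ideal2 A).
Local Notation Q := (quot_alg_type I).
Implicit Types (x y z : A) (c d : k).

HB.instance Definition _ := GRing.Zmodule.on Q.

Definition to_quot x : Q := \pi_({ideal_quot I}) x.
Definition of_quot (u : Q) : A := repr (u : {ideal_quot I}).

Lemma of_quotK u : to_quot (of_quot u) = u.
Proof. exact: reprK. Qed.

Lemma to_quotE x y : (to_quot x = to_quot y) <-> (x - y \in I).
Proof. by rewrite Quotient.idealrBE; split => [/eqP|/eqP]. Qed.

Lemma of_quot_rep x : of_quot (to_quot x) - x \in I.
Proof. by apply/to_quotE; rewrite of_quotK. Qed.

Lemma to_quotD x y : to_quot (x + y) = to_quot x + to_quot y.
Proof. exact: (raddfD (\pi_({ideal_quot I}))). Qed.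

Definition quot_one : Q := to_quot 1.
Definition quot_mul (u v : Q) : Q := to_quot (of_quot u * of_quot v).
Definition quot_scale c (u : Q) : Q := to_quot (c *: of_quot u).

Lemma to_quotM x y : to_quot (x * y) = quot_mul (to_quot x) (to_quot y).
Proof.
apply/esym/to_quotE.
rewrite -[X in X - _](subrK (of_quot (to_quot x) * y)) -mulrBr -addrA -mulrBl.
by apply: rpredD; [apply: ideal2Ml|apply: ideal2Mr]; apply: of_quot_rep.
Qed.

Lemma to_quotZ c x : to_quot (c *: x) = quot_scale c (to_quot x).
Proof.
apply/esym/to_quotE; rewrite -scalerBr -[_ - _]mul1r pzscalerAl.
by apply: ideal2Ml; apply: of_quot_rep.
Qed.

Fact quot_mulA : associative quot_mul.
Proof.
move=> u v w; rewrite -[u]of_quotK -[v]of_quotK -[w]of_quotK.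
by rewrite -!to_quotM mulrA.
Qed.
Fact quot_mul1r : left_id quot_one quot_mul.
Proof. by move=> u; rewrite -[u]of_quotK -to_quotM mul1r. Qed.
Fact quot_mulr1 : right_id quot_one quot_mul.
Proof. by move=> u; rewrite -[u]of_quotK -to_quotM mulr1. Qed.
Fact quot_mulDl : left_distributive quot_mul +%R.
Proof.
move=> u v w; rewrite -[u]of_quotK -[v]of_quotK -[w]of_quotK.
by rewrite -to_quotD -!to_quotM -to_quotD mulrDl.
Qed.
Fact quot_mulDr : right_distributive quot_mul +%R.
Proof.
move=> u v w; rewrite -[u]of_quotK -[v]of_quotK -[w]of_quotK.
by rewrite -to_quotD -!to_quotM -to_quotD mulrDr.
Qed.
HB.instance Definition _ := GRing.Zmodule_isPzRing.Build Q
  quot_mulA quot_mul1r quot_mulr1 quot_mulDl quot_mulDr.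

Fact quot_scaleA c d u : quot_scale c (quot_scale d u) = quot_scale (c * d) u.
Proof. by rewrite -[u]of_quotK -!to_quotZ scalerA. Qed.
Fact quot_scale1 : left_id 1 quot_scale.
Proof. by move=> u; rewrite -[u]of_quotK -to_quotZ scale1r. Qed.
Fact quot_scaleDr : right_distributive quot_scale +%R.
Proof.
move=> c u v; rewrite -[u]of_quotK -[v]of_quotK.
by rewrite -to_quotD -!to_quotZ -to_quotD scalerDr.
Qed.
Fact quot_scaleDl u : {morph quot_scale^~ u : c d / c + d}.
Proof.
by move=> c d; rewrite -[u]of_quotK -!to_quotZ -to_quotD scalerDl.
Qed.
Fact quot_scaleAl c (u v : Q) : quot_scale c (u * v) = quot_scale c u * v.
Proof.
rewrite -[u]of_quotK -[v]of_quotK.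
by rewrite -![_ * _]/(quot_mul _ _) -to_quotM -!to_quotZ -to_quotM pzscalerAl.
Qed.
Fact quot_scaleAr c (u v : Q) : quot_scale c (u * v) = u * quot_scale c v.
Proof.
rewrite -[u]of_quotK -[v]of_quotK.
by rewrite -![_ * _]/(quot_mul _ _) -to_quotM -!to_quotZ -to_quotM pzscalerAr.
Qed.

Definition quot_alg : pzAlgType k := @PzAlgType k Q quot_scale
  quot_scaleA quot_scale1 quot_scaleDr quot_scaleDl quot_scaleAl quot_scaleAr.

End QuotientAlgebra.

Section GelfandKirillov.
Variables (F : realType) (k : fieldType).

Definition lin_span (V : lmodType k) (X : set V) : set V :=
  [set x | exists n (c : 'I_n -> k) (u : 'I_n -> V),
    (forall i, X (u i)) /\ x = \sum_i c i *: u i].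

Definition lin_indep (V : lmodType k) n (u : 'I_n -> V) : Prop :=
  forall c : 'I_n -> k, \sum_i c i *: u i = 0 -> forall i, c i = 0.

(* Dimension of a subspace W, +oo when it is infinite.                         *)
Definition lin_dim (V : lmodType k) (W : set V) : \bar F :=
  ereal_sup [set n%:R%:E | n in
    [set n | exists u : 'I_n -> V, lin_indep u /\ forall i, W (u i)]].

Definition fd_subspace (V : lmodType k) (W : set V) : Prop :=
  exists n (u : 'I_n -> V), W = lin_span (range u).

Variable A : pzAlgType k.

Definition mul_space (V W : set A) : set A :=
  lin_span [set (v * w : A) | v in V & w in W].

Definition pow_space (V : set A) (n : nat) : set A :=
  iter n (mul_space V) (lin_span [set (1 : A)]).

(* V^0 + V^1 + ... + V^n                                                       *)
Definition growth_space (V : set A) (n : nat) : set A :=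
  lin_span (\bigcup_(i in [set i | (i <= n)%N]) pow_space V i).

(* sup_V limsup_n log dim (V^0 + ... + V^n) / log n. As lne 0 = -oo, the zero  *)
(* algebra has dimension -oo.                                                  *)
Definition GKdim : \bar F :=
  ereal_sup [set limn_esup (fun n : nat =>
      lne (lin_dim (growth_space V n)) * ((ln (n%:R : F))^-1)%:E)%E
    | V in [set V : set A | fd_subspace V]].

End GelfandKirillov.

Section ModuleAlgebra.
Variables (k : fieldType) (G : finGroupType) (R : pzAlgType k).

Record module_algebra := ModuleAlgebra {
  gact :> G -> R -> R;
  gact1 : gact 1%g =1 id;
  gactM : forall g h : G, gact (g * h)%g =1 gact g \o gact h;
  gact_linear : forall g, linear (gact g);
  gact_monoid : forall g, monoid_morphism (gact g)
}.

Variable act : module_algebra.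

HB.instance Definition _ g := GRing.isLinear.Build k R R _ (act g)
  (gact_linear act g).
HB.instance Definition _ g := GRing.isMonoidMorphism.Build R R (act g)
  (gact_monoid act g).

Definition pertinent n (a b : 'I_n -> R) : Prop :=
  forall g : G, g != 1%g -> \sum_i a i * act g (b i) = 0.

Definition Gradical_pred : pred R := fun x =>
  `[< exists n (a b : 'I_n -> R),
      [/\ (0 < n)%N, pertinent a b & x = \sum_i a i * b i] >].

Definition ord_join n m (a : 'I_n -> R) (b : 'I_m -> R) (i : 'I_(n + m)) : R :=
  match fintype.split i with inl j => a j | inr j => b j end.

Fact sum_join n m (f : R -> R -> R) (a b : 'I_n -> R) (a' b' : 'I_m -> R) :
  \sum_i f (ord_join a a' i) (ord_join b b' i)
  = \sum_i f (a i) (b i) + \sum_i f (a' i) (b' i).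
Proof.
rewrite big_split_ord /ord_join; congr (_ + _); apply: eq_bigr => i _.
  by rewrite (unsplitK (inl i)).
by rewrite (unsplitK (inr i)).
Qed.

Fact Gradical_zmod : zmod_closed Gradical_pred.
Proof.
split=> [|x y]; rewrite !unfold_in.
  apply/asboolP; exists 1%N, (fun=> 0), (fun=> 0); split=> // [g _|].
    by rewrite big1 // => i _; rewrite mul0r.
  by rewrite big1 // => i _; rewrite mul0r.
move=> /asboolP[n [a [b [n0 pab ->]]]] /asboolP[m [a' [b' [_ pab' ->]]]].
apply/asboolP; exists (n + m)%N, (ord_join a (fun i => - a' i)), (ord_join b b').
split; first by rewrite addn_gt0 n0.
- move=> g g1; rewrite (sum_join (fun x y => x * act g y)) pab // add0r.
  by under eq_bigr do rewrite mulNr; rewrite sumrN pab' ?oppr0.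
- rewrite (sum_join *%R); congr (_ + _).
  by under [RHS]eq_bigr do rewrite mulNr; rewrite sumrN.
Qed.
HB.instance Definition _ :=
  GRing.isZmodClosed.Build R Gradical_pred Gradical_zmod.

Fact Gradical_Ml c x : x \in Gradical_pred -> c * x \in Gradical_pred.
Proof.
rewrite !unfold_in => /asboolP[n [a [b [n0 pab ->]]]].
apply/asboolP; exists n, (fun i => c * a i), b; split=> // [g g1|].
  by under eq_bigr do rewrite -mulrA; rewrite -mulr_sumr pab ?mulr0.
by rewrite mulr_sumr; apply: eq_bigr => i _; rewrite mulrA.
Qed.
Fact Gradical_Mr c x : x \in Gradical_pred -> x * c \in Gradical_pred.
Proof.
rewrite !unfold_in => /asboolP[n [a [b [n0 pab ->]]]].
apply/asboolP; exists n, a, (fun i => b i * c); split=> // [g g1|].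
  by under eq_bigr do rewrite rmorphM mulrA; rewrite -mulr_suml pab ?mul0r.
by rewrite mulr_suml; apply: eq_bigr => i _; rewrite mulrA.
Qed.
HB.instance Definition _ :=
  isIdeal2.Build R Gradical_pred Gradical_Ml Gradical_Mr.
Definition Gradical : ideal2 R := Ideal2.clone _ Gradical_pred _.

(* f stands for the element \sum_g f g (x) g of R (x) kG; the argument only    *)
(* records the action that determines the product.                             *)
Definition skew_alg_type (_ : module_algebra) : Type := {ffun G -> R}.
Local Notation B := (skew_alg_type act).
HB.instance Definition _ := GRing.Lmodule.on B.

Definition skew_tensor (r : R) (g : G) : B :=
  [ffun h => if h == g then r else 0].

Definition skew_mul (x y : B) : B :=
  \sum_g \sum_h skew_tensor (x g * act g (y h)) (g * h)%g.

Lemma skew_mulE (x y : B) (t : G) :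
  skew_mul x y t = \sum_g x g * act g (y (g^-1 * t)%g).
Proof.
rewrite /skew_mul sum_ffunE; apply: eq_bigr => g _; rewrite sum_ffunE.
rewrite (bigD1 (g^-1 * t)%g) //= ffunE mulKVg eqxx big1 ?addr0 // => h hN.
rewrite ffunE; case: eqP => // tE; case/eqP: hN.
by rewrite tE mulKg.
Qed.

Definition skew_one : B := skew_tensor 1 1%g.

Fact skew_mulA : associative skew_mul.
Proof.
move=> x y z; apply/ffunP => t; rewrite !skew_mulE.
under eq_bigr => g _ do rewrite skew_mulE rmorph_sum mulr_sumr.
under [RHS]eq_bigr => g _ do rewrite skew_mulE mulr_suml.
rewrite [RHS]exchange_big; apply: eq_bigr => g _ /=.
rewrite [RHS](reindex_inj (mulgI g)); apply: eq_bigr => h _ /=.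
by rewrite mulKg rmorphM mulrA (gactM act) /= invMg mulgA.
Qed.
Fact skew_mul1r : left_id skew_one skew_mul.
Proof.
move=> x; apply/ffunP => t; rewrite skew_mulE (bigD1 1%g) //= big1 => [|g g1].
  by rewrite ffunE eqxx mul1r (gact1 act) invg1 mul1g addr0.
by rewrite ffunE (negPf g1) mul0r.
Qed.
Fact skew_mulr1 : right_id skew_one skew_mul.
Proof.
move=> x; apply/ffunP => t; rewrite skew_mulE (bigD1 t) //= big1 => [|g gt].
  by rewrite ffunE mulVg eqxx rmorph1 mulr1 addr0.
rewrite ffunE; case: eqP => [E|_]; last by rewrite raddf0 mulr0.
by case/eqP: gt; rewrite -[g]mulg1 -E mulKVg.
Qed.
Fact skew_mulDl : left_distributive skew_mul +%R.
Proof.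
move=> x y z; apply/ffunP => t; rewrite [in RHS]ffunE !skew_mulE -big_split.
by apply: eq_bigr => g _; rewrite ffunE mulrDl.
Qed.
Fact skew_mulDr : right_distributive skew_mul +%R.
Proof.
move=> x y z; apply/ffunP => t; rewrite [in RHS]ffunE !skew_mulE -big_split.
by apply: eq_bigr => g _; rewrite ffunE raddfD mulrDr.
Qed.
HB.instance Definition _ := GRing.Zmodule_isPzRing.Build B
  skew_mulA skew_mul1r skew_mulr1 skew_mulDl skew_mulDr.

Fact skew_scaleAl (c : k) (x y : B) : c *: (x * y) = (c *: x) * y.
Proof.
apply/ffunP => t; rewrite ffunE !skew_mulE scaler_sumr.
by apply: eq_bigr => g _; rewrite ffunE pzscalerAl.
Qed.
Fact skew_scaleAr (c : k) (x y : B) : c *: (x * y) = x * (c *: y).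
Proof.
apply/ffunP => t; rewrite ffunE !skew_mulE scaler_sumr.
by apply: eq_bigr => g _; rewrite ffunE linearZ pzscalerAr.
Qed.

Definition skew_group_alg : pzAlgType k := @PzAlgType k B *:%R
  (@scalerA k B) (@scale1r k B) (@scalerDr k B) (@scalerDl k B)
  skew_scaleAl skew_scaleAr.

Lemma skew_tensorM (r s : R) (g h : G) :
  skew_tensor r g * skew_tensor s h = skew_tensor (r * act g s) (g * h)%g :> B.
Proof.
apply/ffunP => t; rewrite skew_mulE (bigD1 g) //= big1 => [|l lg].
  rewrite !ffunE eqxx addr0 -(inj_eq (mulgI g)) mulKVg.
  by case: ifP; rewrite ?raddf0 ?mulr0.
by rewrite ffunE (negPf lg) mul0r.
Qed.

Definition skew_idem : skew_group_alg :=
  (#|G|%:R : k)^-1 *: \sum_(g : G) skew_tensor 1 g.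

End ModuleAlgebra.

Section PrincipalIdeal.
Variables (A : pzRingType) (e : A).

(* AeA, the additive span of the products a e b.                               *)
Definition principal_pred : pred A := fun x =>
  `[< exists n (a b : 'I_n -> A), x = \sum_i a i * e * b i >].

Fact principal_ideal_zmod : zmod_closed principal_pred.
Proof.
split=> [|x y]; rewrite !unfold_in.
  by apply/asboolP; exists 0%N, (fun=> 0), (fun=> 0); rewrite big_ord0.
move=> /asboolP[n [a [b ->]]] /asboolP[m [a' [b' ->]]]; apply/asboolP.
exists (n + m)%N,
  (fun i => match fintype.split i with inl j => a j | inr j => - a' j end),
  (fun i => match fintype.split i with inl j => b j | inr j => b' j end).
rewrite big_split_ord /=; congr (_ + _); last rewrite -sumrN.
  by apply: eq_bigr => i _; rewrite (unsplitK (inl i)).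
by apply: eq_bigr => i _; rewrite (unsplitK (inr i)) !mulNr.
Qed.
HB.instance Definition _ :=
  GRing.isZmodClosed.Build A principal_pred principal_ideal_zmod.

Fact principal_ideal_Ml c x : x \in principal_pred -> c * x \in principal_pred.
Proof.
rewrite !unfold_in => /asboolP[n [a [b ->]]].
apply/asboolP; exists n, (fun i => c * a i), b; rewrite mulr_sumr.
by apply: eq_bigr => i _; rewrite !mulrA.
Qed.
Fact principal_ideal_Mr c x : x \in principal_pred -> x * c \in principal_pred.
Proof.
rewrite !unfold_in => /asboolP[n [a [b ->]]].
apply/asboolP; exists n, a, (fun i => b i * c); rewrite mulr_suml.
by apply: eq_bigr => i _; rewrite !mulrA.
Qed.
HB.instance Definition _ := isIdeal2.Build A principal_pred
  principal_ideal_Ml principal_ideal_Mr.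
Definition principal_ideal : ideal2 A := Ideal2.clone _ principal_pred _.

End PrincipalIdeal.

(* Main.v *)
(* Write B = R*G. Since g e = e = e g for g in G, every element of BeB is a sum
   of elements a e b with a, b in R, and the coefficient of such a product at g
   is a (g.b)/|G|. Hence an element x of R lies in BeB exactly when x = sum a_i b_i
   for a pertinent pair of sequences, i.e. R /\ BeB is the G-radical. So R/r(R,G)
   embeds in B/BeB, which is generated by the images of the elements of G as a
   right module over it, and a finite extension of this kind does not change the
   Gelfand-Kirillov dimension. *)
Require Import Defs.
From HB Require Import structures.
From mathcomp Require Import all_boot all_order all_algebra all_fingroup.
From mathcomp Require Import all_classical all_reals all_analysis.
Set Implicit Arguments.
Unset Strict Implicit.
Unset Printing Implicit Defensive.
Local Open Scope ring_scope.

Import Order.TTheory GRing.Theory Num.Theory.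
Local Open Scope classical_set_scope.

(** * Subspaces, linear spans and dimension *)

Definition subspace (k : fieldType) (V : lmodType k) (P : set V) : Prop :=
  P 0 /\ forall c x y, P x -> P y -> P (c *: x + y).

Lemma subspaceZ (k : fieldType) (V : lmodType k) (P : set V) c x :
  subspace P -> P x -> P (c *: x).
Proof. by move=> [P0 PL] Px; rewrite -[_ *: _]addr0; apply: PL. Qed.

Lemma subspace_sum (k : fieldType) (V : lmodType k) (P : set V) (T : finType)
    (F : T -> V) :
  subspace P -> (forall t, P (F t)) -> P (\sum_t F t).
Proof.
move=> [P0 PL] PF; apply: big_ind => // x y Px Py.
by rewrite -[x]scale1r; apply: PL.
Qed.

Lemma lin_span_min (k : fieldType) (V : lmodType k) (X P : set V) :
  subspace P -> X `<=` P -> lin_span X `<=` P.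
Proof.
move=> Psub XP _ [n [c [u [Xu ->]]]].
by apply: subspace_sum => // i; apply: subspaceZ => //; apply: XP.
Qed.

Lemma sub_lin_span (k : fieldType) (V : lmodType k) (X : set V) :
  X `<=` lin_span X.
Proof.
move=> x Xx; exists 1%N, (fun=> 1), (fun=> x); split=> //.
by rewrite big_ord1 scale1r.
Qed.

Lemma lin_span_subspace (k : fieldType) (V : lmodType k) (X : set V) :
  subspace (lin_span X).
Proof.
split; first by exists 0%N, (fun=> 0), (fun=> 0); split=> [[]|]; rewrite ?big_ord0.
move=> c _ _ [n [a [u [Xu ->]]]] [m [b [v [Xv ->]]]].
exists (n + m)%N,
  (fun i => match fintype.split i with inl j => c * a j | inr j => b j end),
  (fun i => match fintype.split i with inl j => u j | inr j => v j end).
split; first by move=> i; case: (fintype.split i).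
rewrite big_split_ord scaler_sumr; congr (_ + _); apply: eq_bigr => i _.
  by rewrite (unsplitK (inl i)) scalerA.
by rewrite (unsplitK (inr i)).
Qed.

Lemma lin_span_range (k : fieldType) (V : lmodType k) (T : finType)
    (v : T -> V) (x : V) :
  lin_span (range v) x <-> exists c : T -> k, x = \sum_t c t *: v t.
Proof.
split=> [|[c ->]].
  apply: (@lin_span_min _ _ _ [set x | exists c : T -> k, x = \sum_t c t *: v t]).
    split=> [|a _ _ [c ->] [d ->]].
      by exists (fun=> 0); rewrite big1 // => t _; rewrite scale0r.
    exists (fun t => a * c t + d t); rewrite scaler_sumr -big_split.
    by apply: eq_bigr => t _; rewrite scalerDl scalerA.
  move=> _ [t _ <-]; exists (fun s => (s == t)%:R).
  rewrite (bigD1 t) //= eqxx scale1r big1 ?addr0 // => s /negPf ->.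
  by rewrite scale0r.
apply: subspace_sum; first exact: lin_span_subspace.
move=> t; apply: subspaceZ; first exact: lin_span_subspace.
by apply: sub_lin_span; exists t.
Qed.

Lemma fd_subspace_range (k : fieldType) (V : lmodType k) (T : finType)
    (v : T -> V) : fd_subspace (lin_span (range v)).
Proof.
exists #|T|, (v \o enum_val); congr lin_span.
apply/seteqP; split=> _ [t _ <-]; last by exists (enum_val t).
by exists (enum_rank t) => //=; rewrite enum_rankK.
Qed.

(** A coefficient matrix with more rows than columns has a nonzero left kernel vector, which would
    be a linear relation among the [u i]. *)
Lemma lin_indep_card (k : fieldType) (V : lmodType k) (T : finType)
    (v : T -> V) p (u : 'I_p -> V) :
  lin_indep u -> (forall i, lin_span (range v) (u i)) -> (p <= #|T|)%N.
Proof.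
move=> uI uv.
have [c cE] := choice (fun i => (lin_span_range v (u i)).1 (uv i)).
pose M : 'M[k]_(p, #|T|) := \matrix_(i, j) c i (enum_val j).
rewrite leqNgt; apply/negP => ltTp.
have : kermx M != 0.
  by rewrite -mxrank_eq0 mxrank_ker subn_eq0 -ltnNge (leq_ltn_trans (rank_leq_col M)).
case/rowV0Pn => w /sub_kermxP wM /eqP; apply.
apply/rowP => i; rewrite mxE; apply: (uI (w 0)).
under eq_bigr do rewrite cE scaler_sumr.
rewrite exchange_big big1 //= => t _.
under eq_bigr do rewrite scalerA.
rewrite -scaler_suml; move/rowP/(_ (enum_rank t)): wM; rewrite !mxE.
under eq_bigr do rewrite mxE enum_rankK.
by move=> ->; rewrite scale0r.
Qed.

(** In a relation where [x] has a nonzero coefficient, dividing by that coefficient would put [x] in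
    the span of [u]. *)
Lemma lin_indep_extend (k : fieldType) (V : lmodType k) n (u : 'I_n -> V) x :
  lin_indep u -> ~ lin_span (range u) x ->
  lin_indep (fun i : 'I_n.+1 => oapp u x (unlift ord0 i)).
Proof.
move=> uI ux c; rewrite big_ord_recl unlift_none /=.
under eq_bigr do rewrite liftK /=.
have [c0|c0] := eqVneq (c ord0) 0.
  rewrite c0 scale0r add0r => /uI cl i.
  by case: (unliftP ord0 i) => [j ->|-> //]; exact: cl.
move=> E; case: ux; apply/lin_span_range.
exists (fun i => - (c ord0)^-1 * c (lift ord0 i)).
under eq_bigr do rewrite -scalerA.
rewrite -scaler_sumr; move/eqP: E; rewrite addr_eq0 => /eqP E.
by rewrite scaleNr -scalerN -E scalerA mulVf // scale1r.
Qed.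

Lemma lin_dim_ge0 (F : realType) (k : fieldType) (V : lmodType k) (W : set V) :
  (0 <= lin_dim F W)%E.
Proof.
apply: ereal_sup_ubound; exists 0%N => //; exists (fun=> 0).
by split=> [c _|] [].
Qed.

(** Finiteness bounds the length of independent families in [W], so a longest one exists, and it
    must span [W]. *)
Lemma lin_dim_spanning (F : realType) (k : fieldType) (V : lmodType k)
    (W : set V) : (lin_dim F W < +oo)%E ->
  exists n (u : 'I_n -> V),
    (n%:R%:E <= lin_dim F W)%E /\ W `<=` lin_span (range u).
Proof.
pose S n := exists u : 'I_n -> V, lin_indep u /\ forall i, W (u i).
have Sle n : S n -> (n%:R%:E <= lin_dim F W)%E.
  by move=> Sn; apply: ereal_sup_ubound; exists n.
move=> Wfin; have /fineK dE : (lin_dim F W \is a fin_num)%E.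
  by rewrite ge0_fin_numE // lin_dim_ge0.
have S0 : exists n, `[< S n >].
  by exists 0%N; apply/asboolP; exists (fun=> 0); split=> [c _|] [].
have Sub n : `[< S n >] -> (n <= Num.bound (fine (lin_dim F W)))%N.
  move=> /asboolP/Sle; rewrite -dE lee_fin => nle.
  rewrite -(ler_nat F) (le_trans nle) // ltW // archi_boundP //.
  by rewrite fine_ge0 // lin_dim_ge0.
have [n /asboolP Sn nmax] := ex_maxnP S0 Sub.
have [u [uI Wu]] := Sn; exists n, u; split; first exact: Sle.
move=> x Wx; apply: contrapT => ux.
(* A vector outside the span would give a longer independent family, against the maximality of
   [n]. *)
suff /asboolP/nmax : S n.+1 by rewrite ltnn.
exists (fun i => oapp u x (unlift ord0 i)).
split; first exact: lin_indep_extend.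
by move=> i; case: (unliftP ord0 i) => [j _|_] //=; exact: Wu.
Qed.

Lemma lin_dim_inj (F : realType) (k : fieldType) (V V' : lmodType k)
    (f : {linear V -> V'}) (W : set V) (W' : set V') :
  injective f -> f @` W `<=` W' -> (lin_dim F W <= lin_dim F W')%E.
Proof.
move=> fI fW; apply: ge_ereal_sup => _ [n [u [uI Wu]] <-].
apply: ereal_sup_ubound; exists n => //; exists (f \o u); split; last first.
  by move=> i; apply: fW; exists (u i).
move=> c /= c0; apply: uI; apply: fI; rewrite linear0 linear_sum -[RHS]c0.
by apply: eq_bigr => i _; rewrite linearZ.
Qed.

(** If the [u j] span [W], the vectors [phi t (u j)], indexed by [T * 'I_n], span a space containing
    [W']. *)
Lemma lin_dim_sum (F : realType) (k : fieldType) (V V' : lmodType k)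
    (T : finType) (phi : T -> {linear V -> V'}) (W : set V) (W' : set V') :
  (0 < #|T|)%N ->
  (forall x, W' x -> exists d : T -> V,
    (forall t, W (d t)) /\ x = \sum_t phi t (d t)) ->
  (lin_dim F W' <= #|T|%:R%:E * lin_dim F W)%E.
Proof.
move=> T0 WW'; have [->|] := eqVneq (lin_dim F W) +oo%E.
  by rewrite gt0_muley ?leey // lte_fin ltr0n.
rewrite -ltey => /lin_dim_spanning[n [u [nW Wu]]].
apply: (@le_trans _ _ (#|T| * n)%:R%:E); last first.
  by rewrite natrM EFinM lee_wpmul2l // lee_fin.
apply: ge_ereal_sup => _ [p [w [wI W'w]] <-]; rewrite lee_fin ler_nat.
have := lin_indep_card (v := fun s : T * 'I_n => phi s.1 (u s.2)) wI.
rewrite card_prod card_ord; apply.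
move=> i; have [d [Wd ->]] := WW' _ (W'w i).
apply: subspace_sum => [|t]; first exact: lin_span_subspace.
have /lin_span_range[c ->] := Wu _ (Wd t); rewrite linear_sum.
apply: subspace_sum => [|j]; first exact: lin_span_subspace.
rewrite linearZ; apply: subspaceZ; first exact: lin_span_subspace.
by apply: sub_lin_span; exists (t, j).
Qed.

(** * Comparison of logarithmic growth rates *)

Lemma lne_le_add (F : realType) (m : nat) (x y : \bar F) :
  (0 < m)%N -> (0 <= x)%E -> (0 <= y)%E -> (x <= m%:R%:E * y)%E ->
  (lne x <= lne y + (ln m%:R)%:E)%E.
Proof.
move=> m0 x0 y0 xy; have m0F : (0 < m%:R :> F) by rewrite ltr0n.
move: y0; rewrite le_eqVlt => /predU1P[y0|y0].
  (* Here [x] vanishes too, and [lne x] is [-oo]. *)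
  move: xy; rewrite -y0 mule0 => xy.
  by rewrite le0_lneNy ?leNye.
rewrite -lne_EFin // addeC -lneM ?in_itv /= ?lte_fin ?m0F ?y0 ?leey //.
by rewrite lee_lne // in_itv /= ?x0 ?leey // mule_ge0 // ltW.
Qed.

Lemma limn_esup_le_add (F : realType) (u v : (\bar F)^nat) :
  (forall e : F, 0 < e -> \forall n \near \oo, (u n <= v n + e%:E)%E) ->
  (limn_esup u <= limn_esup v)%E.
Proof.
move=> uv; apply/lee_addgt0Pr => e /uv ue.
rewrite -leeBlDr //; apply: le_ereal_inf_tmp => _ [A Ainf <-].
rewrite leeBlDr //; apply: ge_ereal_inf.
(* Cutting [A] down to the indices where the bound holds keeps it in the filter. *)
exists (ereal_sup (u @` (A `&` [set n | (u n <= v n + e%:E)%E]))).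
  by eexists; last reflexivity; exact: filterI.
apply: ge_ereal_sup => _ [n [An /= uvn] <-]; apply: (le_trans uvn).
by rewrite leeD2r //; apply: ereal_sup_ubound; exists n.
Qed.

(** The factor [m] adds only [ln m / ln n] to the rate, and this tends to 0. *)
Lemma limn_esup_growth (F : realType) (m : nat) (a b : (\bar F)^nat) :
  (0 < m)%N -> (forall n, 0 <= a n)%E -> (forall n, 0 <= b n)%E ->
  (forall n, a n <= m%:R%:E * b n)%E ->
  (limn_esup (fun n => lne (a n) * ((ln (n%:R : F))^-1)%:E) <=
   limn_esup (fun n => lne (b n) * ((ln (n%:R : F))^-1)%:E))%E.
Proof.
move=> m0 a0 b0 ab; apply: limn_esup_le_add => e e0.
near=> n.
have n1 : 1 < n%:R :> F by rewrite ltr1n; near: n; exact: nbhs_infty_gt.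
have ln0 : 0 < ln (n%:R : F) by exact: ln_gt0.
(* This holds as soon as [n] is at least [expR (e^-1 * ln m)]. *)
have mn : ln (m%:R : F) / ln n%:R <= e.
  rewrite ler_pdivrMr // -ler_pdivrMl // -ler_expR lnK; last first.
    by rewrite posrE (lt_trans ltr01).
  by near: n; exact: nbhs_infty_ger.
apply: (@le_trans _ _ ((lne (b n) + (ln m%:R)%:E) * ((ln n%:R)^-1)%:E)%E).
  by apply: lee_wpmul2r; [rewrite lee_fin invr_ge0 ltW | exact: lne_le_add].
by rewrite muleDl ?fin_num_adde_defl // -EFinM leeD2l // lee_fin.
Unshelve. all: by end_near. Qed.

(** * Gelfand-Kirillov dimension under injections and finite extensions *)

Lemma pow_space_subspace (k : fieldType) (A : pzAlgType k) (V : set A) n :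
  subspace (pow_space V n).
Proof. by case: n => [|n]; exact: lin_span_subspace. Qed.

Lemma GKdim_inj (F : realType) (k : fieldType) (A C : pzAlgType k)
    (f : {linear A -> C}) :
  monoid_morphism f -> injective f -> (GKdim F A <= GKdim F C)%E.
Proof.
move=> [f1 fM] fI; apply: ge_ereal_sup => _ [V [n [v VE]] <-].
apply: (@le_trans _ _ (limn_esup (fun n : nat =>
  lne (lin_dim F (growth_space (f @` V) n)) * ((ln (n%:R : F))^-1)%:E)%E));
  last first.
  apply: ereal_sup_ubound; exists (f @` V) => //; exists n, (f \o v).
  rewrite VE; apply/seteqP; split=> [_ [_ /lin_span_range[c ->] <-]|x].
    apply/lin_span_range; exists c; rewrite linear_sum.
    by apply: eq_bigr => i _; rewrite linearZ.
  move=> /lin_span_range[c ->]; exists (\sum_i c i *: v i).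
    by apply/lin_span_range; exists c.
  by rewrite linear_sum; apply: eq_bigr => i _; rewrite linearZ.
apply: (@limn_esup_growth _ 1) => // m; rewrite ?lin_dim_ge0 // mul1e.
apply: (lin_dim_inj F fI) => _ [x Wx <-].
have preim_subspace (P : set C) : subspace P -> subspace (f @^-1` P).
  move=> [P0 PL]; split; first by rewrite /= linear0.
  by move=> c y z Py Pz; rewrite /= linearP; exact: PL.
have pow_f i : pow_space V i `<=` f @^-1` pow_space (f @` V) i.
  elim: i => [|i IH]; apply: lin_span_min.
  - by apply: preim_subspace; exact: lin_span_subspace.
  - by move=> _ ->; apply: sub_lin_span; rewrite /= f1.
  - by apply: preim_subspace; exact: lin_span_subspace.
  - move=> _ [a Va [b Vb <-]]; apply: sub_lin_span; rewrite /= fM.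
    by exists (f a); [exists a|exists (f b); first exact: IH].
apply: (lin_span_min (P := f @^-1` growth_space (f @` V) m) _ _ Wx).
  by apply: preim_subspace; exact: lin_span_subspace.
by move=> y [i im Vy]; apply: sub_lin_span; exists i => //; exact: pow_f.
Qed.

(** This is the sum of the [u t * f(D)]. Coefficients stand on the right, so that left
    multiplication by [C] acts on the generators [u t]. *)
Definition modspan (k : fieldType) (A C : pzAlgType k) (T : finType)
    (f : A -> C) (u : T -> C) (D : set A) : set C :=
  [set x | exists d : T -> A, (forall t, D (d t)) /\ x = \sum_t u t * f (d t)].

Lemma modspan_subspace (k : fieldType) (A C : pzAlgType k) (T : finType)
    (f : {linear A -> C}) (u : T -> C) (D : set A) :
  subspace D -> subspace (modspan f u D).
Proof.
move=> [D0 DL]; split.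
  exists (fun=> 0); split=> //; rewrite big1 // => t _.
  by rewrite linear0 mulr0.
move=> c _ _ [d [Dd ->]] [d' [Dd' ->]]; exists (fun t => c *: d t + d' t).
split=> [t|]; first exact: DL.
rewrite scaler_sumr -big_split; apply: eq_bigr => t _.
by rewrite linearP mulrDr pzscalerAr.
Qed.

Lemma modspan_mul (k : fieldType) (A C : pzAlgType k) (T : finType)
    (f : {linear A -> C}) (u : T -> C) (D D' : set A) (x : C) (a : A) :
  {morph f : a b / a * b} ->
  modspan f u D x -> D' a -> modspan f u (mul_space D D') (x * f a).
Proof.
move=> fM [d [Dd ->]] D'a; exists (fun t => d t * a); split=> [t|].
  by apply: sub_lin_span; exists (d t) => //; exists a.
by rewrite mulr_suml; apply: eq_bigr => t _; rewrite fM mulrA.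
Qed.

(** The induction on powers treats all [u t] at once: if [w * u t] is the sum of the
    [u s * f (d s)], then [v * w * u t] involves every [v * u s], which the hypothesis expands with
    coefficients in [W]. *)
Lemma growth_modspan (k : fieldType) (A C : pzAlgType k) (T : finType)
    (f : {linear A -> C}) (u : T -> C) (t1 : T) (V : set C) (W : set A) n :
  monoid_morphism f -> u t1 = 1 ->
  (forall v t, V v -> modspan f u W (v * u t)) ->
  growth_space V n `<=` modspan f u (growth_space W n).
Proof.
move=> [f1 fM] u1 VW.
have sub_l (P : set C) t : subspace P -> subspace [set x | P (x * u t)].
  move=> [P0 PL]; split; first by rewrite /= mul0r.
  by move=> c y z Py Pz; rewrite /= mulrDl -pzscalerAl; exact: PL.
have pow_u i t :
    pow_space V i `<=` [set x | modspan f u (pow_space W i) (x * u t)].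
  elim: i t => [|i IH] t; apply: lin_span_min => [|x].
  - by apply/sub_l/modspan_subspace; exact: lin_span_subspace.
  (* In degree 0 the product is [u t] itself, with Kronecker coefficients in the span of 1. *)
  - move=> ->; rewrite /= mul1r; exists (fun s => (s == t)%:R); split=> [s|].
      case: (s == t); last by have [] := lin_span_subspace [set (1 : A)].
      exact: sub_lin_span.
    rewrite (bigD1 t) //= eqxx f1 mulr1 big1 ?addr0 // => s /negPf ->.
    by rewrite linear0 mulr0.
  - by apply/sub_l/modspan_subspace; exact: lin_span_subspace.
  - move=> [v Vv [w Vw <-]] /=; rewrite -mulrA.
    have [d [Wd ->]] := IH t _ Vw; rewrite mulr_sumr.
    apply: subspace_sum => [|s].
      by apply: modspan_subspace; exact: lin_span_subspace.
    by rewrite mulrA; apply: modspan_mul => //; exact: VW.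
apply: lin_span_min => [|x [i im Vx]].
  by apply: modspan_subspace; exact: lin_span_subspace.
rewrite -[x]mulr1 -u1; have [d [Wd ->]] := pow_u _ t1 _ Vx.
by exists d; split=> // t; apply: sub_lin_span; exists i.
Qed.

(* If [C = \sum_t u_t f(A)] and [v u_t] lies in [\sum_s u_s f(W)] for [v] in V, *)
(* then [V^n = V^n u_(t1)] is contained in [\sum_s u_s f(W^n)]: the growth is   *)
(* multiplied by [#|T|] at most, which the logarithmic rate does not see.       *)
Lemma GKdim_finite (F : realType) (k : fieldType) (A C : pzAlgType k)
    (T : finType) (f : {linear A -> C}) (u : T -> C) (t1 : T) :
  monoid_morphism f -> u t1 = 1 -> (forall x, modspan f u setT x) ->
  (GKdim F C <= GKdim F A)%E.
Proof.
move=> fmon u1 fu; have T0 : (0 < #|T|)%N by apply/card_gt0P; exists t1.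
apply: ge_ereal_sup => _ [V [n [v VE]] <-].
have [w wE] := choice (fun s : 'I_n * T => fu (v s.1 * u s.2)).
(* [W] is spanned by all coefficients of the finitely many products [v i * u t]. *)
pose W := lin_span (range (fun s : ('I_n * T) * T => w s.1 s.2)).
apply: (@le_trans _ _ (limn_esup (fun n : nat =>
  lne (lin_dim F (growth_space W n)) * ((ln (n%:R : F))^-1)%:E)%E)); last first.
  by apply: ereal_sup_ubound; exists W => //; exact: fd_subspace_range.
apply: (limn_esup_growth T0) => m; rewrite ?lin_dim_ge0 //.
have phi_linear t : linear (fun a => u t * f a).
  by move=> c a b; rewrite linearP mulrDr pzscalerAr.
pose phi t : {linear A -> C} :=
  HB.pack (fun a => u t * f a) (GRing.isLinear.Build _ _ _ _ _ (phi_linear t)).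
apply: (lin_dim_sum F (phi := phi) T0).
apply: (growth_modspan fmon u1) => x t; rewrite VE => /lin_span_range[c ->].
rewrite mulr_suml; apply: subspace_sum => [|i].
  by apply: modspan_subspace; exact: lin_span_subspace.
rewrite -pzscalerAl; apply: subspaceZ.
  by apply: modspan_subspace; exact: lin_span_subspace.
exists (w (i, t)); split=> [s|]; last exact: (wE (i, t)).2.
by apply: sub_lin_span; exists (i, t, s).
Qed.

(** * Morphisms between quotient algebras *)

Definition quot_map (k : fieldType) (A : pzAlgType k) (I : ideal2 A) (x : A) :
  quot_alg I := to_quot I x.

Lemma quot_map_eq (k : fieldType) (A : pzAlgType k) (I : ideal2 A) (x y : A) :
  quot_map I x = quot_map I y <-> x - y \in I.
Proof. exact: to_quotE. Qed.

Lemma quot_map_surj (k : fieldType) (A : pzAlgType k) (I : ideal2 A)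
    (z : quot_alg I) : exists x, z = quot_map I x.
Proof. by exists (of_quot z); rewrite /quot_map of_quotK. Qed.

Lemma quot_map_linear (k : fieldType) (A : pzAlgType k) (I : ideal2 A) :
  linear (quot_map I).
Proof. by move=> c x y; rewrite /quot_map to_quotD to_quotZ. Qed.
HB.instance Definition _ (k : fieldType) (A : pzAlgType k) (I : ideal2 A) :=
  GRing.isLinear.Build k A (quot_alg I) _ (quot_map I) (@quot_map_linear k A I).

Lemma quot_mapM (k : fieldType) (A : pzAlgType k) (I : ideal2 A) :
  {morph quot_map I : x y / x * y}.
Proof. exact: to_quotM. Qed.

(** Of the equivalence between [h x \in J] and [x \in I], one direction makes the induced map well
    defined and the other makes it injective. *)
Lemma quot_hom (k : fieldType) (A C : pzAlgType k) (I : ideal2 A)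
    (J : ideal2 C) (h : {linear A -> C}) :
  monoid_morphism h -> (forall x, (h x \in J) = (x \in I)) ->
  exists f : {linear quot_alg I -> quot_alg J},
    [/\ monoid_morphism f, injective f &
        forall x, f (quot_map I x) = quot_map J (h x)].
Proof.
move=> [h1 hM] hJ; pose f (z : quot_alg I) := quot_map J (h (of_quot z)).
have fE x : f (quot_map I x) = quot_map J (h x).
  by apply/quot_map_eq; rewrite -linearB hJ; exact: of_quot_rep.
have f_linear : linear f.
  move=> c y z; have [{}y ->] := quot_map_surj y; have [{}z ->] := quot_map_surj z.
  by rewrite -linearP !fE !linearP.
pose fL : {linear quot_alg I -> quot_alg J} :=
  HB.pack f (GRing.isLinear.Build _ _ _ _ _ f_linear).
exists fL; split=> //=.
- split; first by rewrite -[1]/(quot_map I 1) fE h1.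
  move=> y z; have [{}y ->] := quot_map_surj y; have [{}z ->] := quot_map_surj z.
  by rewrite -quot_mapM !fE hM quot_mapM.
- move=> y z; have [{}y ->] := quot_map_surj y; have [{}z ->] := quot_map_surj z.
  by rewrite !fE => /quot_map_eq; rewrite -linearB hJ => /quot_map_eq.
Qed.

(** * The copy of [R] in the skew group algebra and its trace on [BeB] *)

Definition skew_incl (k : fieldType) (G : finGroupType) (R : pzAlgType k)
  (act : module_algebra G R) (x : R) : skew_group_alg act :=
  skew_tensor act x 1%g.

Lemma skew_incl_linear (k : fieldType) (G : finGroupType) (R : pzAlgType k)
  (act : module_algebra G R) : linear (skew_incl act).
Proof.
move=> c x y; apply/ffunP => g; rewrite !ffunE.
by case: eqP => //; rewrite scaler0 addr0.
Qed.
HB.instance Definition _ (k : fieldType) (G : finGroupType) (R : pzAlgType k)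
    (act : module_algebra G R) :=
  GRing.isLinear.Build k R (skew_group_alg act) _ (skew_incl act)
    (@skew_incl_linear k G R act).

Lemma skew_incl_monoid (k : fieldType) (G : finGroupType) (R : pzAlgType k)
  (act : module_algebra G R) : monoid_morphism (skew_incl act).
Proof.
split=> // x y; rewrite /skew_incl.
by have := skew_tensorM act x y 1%g 1%g; rewrite (Defs.gact1 act) mulg1 => <-.
Qed.

(* As [g e = e = e g], the idempotent absorbs the group elements of [a] and of *)
(* [b]: [a e b = alpha e beta] with [alpha] and [beta] in R.                   *)
Lemma skew_idem_sandwich (k : fieldType) (G : finGroupType) (R : pzAlgType k)
    (act : module_algebra G R) (a b : skew_group_alg act) (t : G) :
  (a * skew_idem act * b : {ffun G -> R}) t =
  (#|G|%:R : k)^-1 *: ((\sum_g (a : {ffun G -> R}) g) *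
     act t (\sum_h act h^-1%g ((b : {ffun G -> R}) h))).
Proof.
set e := skew_idem act; have eE h : (e : {ffun G -> R}) h = (#|G|%:R : k)^-1 *: (1 : R).
  rewrite /e /skew_idem ffunE sum_ffunE (bigD1 h) //= ffunE eqxx big1 ?addr0 //.
  by move=> g /negPf gh; rewrite ffunE eq_sym gh.
have aeE s : (a * e : {ffun G -> R}) s =
    (#|G|%:R : k)^-1 *: \sum_g (a : {ffun G -> R}) g.
  rewrite [LHS](skew_mulE (act := act)) scaler_sumr; apply: eq_bigr => g _.
  by rewrite eE linearZ rmorph1 -pzscalerAr mulr1.
rewrite [LHS](skew_mulE (act := act)) pzscalerAl [act t _]raddf_sum mulr_sumr.
(* The substitution of [t * g^-1] for [g] makes the argument of [b] equal to [g] and splits off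
   [act t]. *)
rewrite (reindex_inj (mulgI t)) (reindex_inj invg_inj); apply: eq_bigr => g _ /=.
by rewrite aeE (Defs.gactM act) /= invMg invgK mulgVK.
Qed.

Lemma skew_incl_sandwich (k : fieldType) (G : finGroupType) (R : pzAlgType k)
    (act : module_algebra G R) (a b : R) (t : G) :
  (skew_incl act a * skew_idem act * skew_incl act b : {ffun G -> R}) t =
  (#|G|%:R : k)^-1 *: (a * act t b).
Proof.
rewrite [LHS]skew_idem_sandwich; congr (_ *: (_ * act t _)).
  rewrite (bigD1 1%g) //= ffunE eqxx big1 ?addr0 // => g /negPf g1.
  by rewrite ffunE g1.
rewrite (bigD1 1%g) //= ffunE eqxx big1 => [|g /negPf g1].
  by rewrite invg1 (Defs.gact1 act) addr0.
by rewrite ffunE g1 linear0.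
Qed.

(** The coefficients of [skew_incl act x] away from 1 vanish, which is pertinence; its coefficient
    at 1 is [x], which is the sum defining the radical. *)
Lemma skew_incl_principal (k : fieldType) (G : finGroupType) (R : pzAlgType k)
    (act : module_algebra G R) (x : R) :
  #|G|%:R != 0 :> k ->
  (skew_incl act x \in principal_ideal (skew_idem act)) = (x \in Gradical act).
Proof.
move=> G0; apply/asboolP/asboolP => [[n [a [b xE]]]|[n [a [b [n0 ab ->]]]]].
  (* These are the two factors of the sandwich formula, with the scalar of the idempotent moved into
     the left one. *)
  pose al i := (#|G|%:R : k)^-1 *: \sum_g (a i : {ffun G -> R}) g.
  pose be i := \sum_h act h^-1%g ((b i : {ffun G -> R}) h).
  have coefE t : (skew_incl act x : {ffun G -> R}) t = \sum_i al i * act t (be i).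
    rewrite xE [LHS]sum_ffunE; apply: eq_bigr => i _.
    by rewrite [LHS]skew_idem_sandwich pzscalerAl.
  have xal : x = \sum_i al i * be i.
    have := coefE 1%g; rewrite ffunE eqxx => ->.
    by apply: eq_bigr => i _; rewrite (Defs.gact1 act).
  (* The radical asks for [0 < n], so a pair of zeros is prepended. *)
  exists n.+1, (fun i => oapp al 0 (unlift ord0 i)),
    (fun i => oapp be 0 (unlift ord0 i)); split=> // [g g1|].
    rewrite big_ord_recl unlift_none /= mul0r add0r.
    under eq_bigr do rewrite liftK /=.
    by rewrite -coefE ffunE (negPf g1).
  rewrite big_ord_recl unlift_none /= mul0r add0r.
  by under eq_bigr do rewrite liftK /=.
(* The factor [#|G|] cancels the denominator of the idempotent. *)
exists n, (fun i => skew_incl act ((#|G|%:R : k) *: a i)),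
  (fun i => skew_incl act (b i)).
apply/ffunP => t; rewrite [RHS]sum_ffunE.
transitivity (\sum_i a i * act t (b i)).
  rewrite ffunE; case: eqVneq => [->|/ab-> //].
  by apply: eq_bigr => i _; rewrite (Defs.gact1 act).
apply: eq_bigr => i _; rewrite [RHS]skew_incl_sandwich.
by rewrite -pzscalerAl scalerA mulVf // scale1r.
Qed.

(** Moving a coefficient [r] at [g] to the right of [g] turns it into [act g^-1 r]; so the group
    elements generate [B] as a right [R]-module. *)
Lemma skew_tensor_decomp (k : fieldType) (G : finGroupType) (R : pzAlgType k)
    (act : module_algebra G R) (b : skew_group_alg act) :
  b = \sum_g (skew_tensor act 1 g : skew_group_alg act) *
        skew_incl act (act g^-1%g ((b : {ffun G -> R}) g)).
Proof.
under eq_bigr => g _ do rewrite [_ * _](skew_tensorM act) mul1r mulg1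
  -[act g _]/((act g \o act g^-1%g) _) -(Defs.gactM act) mulgV (Defs.gact1 act).
apply/ffunP => h; rewrite sum_ffunE (bigD1 h) //= ffunE eqxx big1 ?addr0 //.
by move=> g /negPf gh; rewrite ffunE eq_sym gh.
Qed.

Theorem proposition3p3 (F : realType) (k : fieldType) (G : finGroupType)
    (R : pzAlgType k) (act : module_algebra G R)
    (G_nontrivial : (1 < #|G|)%N)
    (char_ndvd : forall p, p \in [pchar k] -> ~~ (p %| #|G|)%N)
    (R_noetherian : noetherian R)
    (R_GKfinite : (GKdim F R < +oo)%E) :
  (GKdim F R - GKdim F (quot_alg (Gradical act))
   = GKdim F R - GKdim F (quot_alg (principal_ideal (skew_idem act))))%E.
Proof.
(* A prime divisor of [#|G|] is never the characteristic, so the order is invertible in [k]. *)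
have G0 : #|G|%:R != 0 :> k.
  rewrite natf_neq0_pchar; apply/pnatP => [|p _ pG]; first exact: ltnW.
  by apply: contraL pG => /char_ndvd.
have [f [fmon fI fE]] := quot_hom (skew_incl_monoid act)
  (fun x => skew_incl_principal act x G0).
(* One inequality comes from the embedding [f], the other from the images of the group elements
   generating [B/BeB] over it. *)
congr (_ - _)%E; apply/le_anti/andP; split; first exact: GKdim_inj fmon fI.
apply: (GKdim_finite F (f := f) (t1 := 1%g)
  (u := fun g => quot_map _ (skew_tensor act 1 g : skew_group_alg act))) => //.
move=> z; have [{}z ->] := quot_map_surj z.
exists (fun g => quot_map _ (act g^-1%g ((z : {ffun G -> R}) g))); split=> //.
rewrite {1}[z]skew_tensor_decomp linear_sum; apply: eq_bigr => g _.
by rewrite [LHS]quot_mapM fE.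
Qed.
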